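(* Let $\mu$ be a stationary, ergodic cocycle measure on $\mathbb{Z}^2$ with $0<h,v<1$. Then $\mu$-a.s. every infinite cluster $C$ contains a strictly northwest-southeast directed bi-infinite path of edges labelled $0$. More precisely, $\mu$-a.s. for every infinite cluster $C$ the left boundary of $C$ is well defined and forms such a path.
   Context: Label the nearest-neighbour edges of $\mathbb{Z}^2$ with $0$ or $1$; configurations live in $\{0,1\}^E$, $E$ being the edge set, with the product $\sigma$-field. For a vertex-self-avoiding path $\pi$ from $x$ to $y$, let $\pi^+$ be the set of its edges travelled to the right or upwards, and $\pi^-$ the set of its edges travelled to the left or downwards. A configuration has the cocycle property if for all vertices $x,y$ both (number of edges labelled $1$ in $\pi^+$ minus number labelled $1$ in $\pi^-$) and (number of edges labelled $0$ in $\pi^+$ minus number labelled $0$ in $\pi^-$) are the same for all such paths $\pi$ from $x$ to $y$. Equivalently, on every unit square: label(bottom) + label(right) = label(left) + label(top). A cocycle measure is a probability measure $\mu$ on $\{0,1\}^E$ concentrated on configurations with the cocycle property. Stationary means invariant under all translations of $\mathbb{Z}^2$; ergodic means ergodic with respect to the group of all translations of $\mathbb{Z}^2$. $h$ and $v$ are the expectations under $\mu$ of the label of a horizontal, respectively vertical, edge; it is assumed that $0<h,v<1$. The cluster $C(z)$ of a vertex $z$ is the set of vertices that can be reached from $z$ by travelling over edges labelled $0$ only. An edge is in a cluster $C$ if it is labelled $0$ and its endpoints belong to $C$. A bi-infinite path is strictly northwest-southeast directed if, traversed in one of its two directions, each of its steps goes one unit to the right or one unit down. Left boundary of an infinite cluster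 $C$: for $n\in\mathbb{Z}$ let $e_n$ be the leftmost vertical edge in $C$ between the lines $\{y=n\}$ and $\{y=n+1\}$. The left boundary of $C$ is the union over $n\in\mathbb{Z}$ of the edges $e_n$ together with the horizontal edges (if any) on the line $\{y=n+1\}$ lying between the upper endpoint of $e_n$ and the lower endpoint of $e_{n+1}$. It is well defined if $e_n$ exists for every $n\in\mathbb{Z}$. *)

(* Defs.v *)
From HB Require Import structures.
From mathcomp Require Import all_boot all_order all_algebra.
From mathcomp Require Import boolp classical_sets functions cardinality reals.
From mathcomp Require Import ereal topology normedtype measure lebesgue_measure.
From mathcomp Require Import lebesgue_integral probability.

Set Implicit Arguments.
Unset Strict Implicit.
Unset Printing Implicit Defensive.

Import Order.TTheory GRing.Theory Num.Theory.
Local Open Scope classical_set_scope.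
Local Open Scope ring_scope.

Definition vertex : Type := (int * int)%type.

Definition dir1 : vertex := (1, 0).
Definition dir2 : vertex := (0, 1).

(* An edge is given by its lower-left endpoint and its orientation:
   [(z, true)] is {z, z + dir1} (horizontal), [(z, false)] is {z, z + dir2}
   (vertical). *)
Definition edge : Type := (vertex * bool)%type.

Definition hedge (z : vertex) : edge := (z, true).
Definition vedge (z : vertex) : edge := (z, false).

Definition edge_fst (e : edge) : vertex := e.1.
Definition edge_snd (e : edge) : vertex := e.1 + (if e.2 then dir1 else dir2).

Definition up_right_step (x y : vertex) : bool :=
  (y == x + dir1) || (y == x + dir2).

Definition adj (x y : vertex) : bool := up_right_step x y || up_right_step y x.

(* Meaningful only when [adj x y]. *)
Definition edge_between (x y : vertex) : edge :=
  ((Num.min x.1 y.1, Num.min x.2 y.2), x.2 == y.2).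

(* Labels are booleans: [true] is the label 1 and [false] is the label 0. *)
Definition cylinders : set (set (edge -> bool)) :=
  [set A | exists (e : edge) (b : bool), A = [set w | w e = b]].

(* {0,1}^E with the product sigma-field. *)
Definition config := g_sigma_algebraType cylinders.

(* As in path.v, the vertices of a finite path from [x] are [x :: p]. *)
Definition self_avoiding_path (x y : vertex) (p : seq vertex) : bool :=
  [&& path adj x p, uniq (x :: p) & last x p == y].

Definition steps (x : vertex) (p : seq vertex) : seq (vertex * vertex) :=
  zip (x :: p) p.

Definition plus_edges (x : vertex) (p : seq vertex) : seq edge :=
  [seq edge_between s.1 s.2 | s <- steps x p & up_right_step s.1 s.2].

Definition minus_edges (x : vertex) (p : seq vertex) : seq edge :=
  [seq edge_between s.1 s.2 | s <- steps x p & up_right_step s.2 s.1].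

Definition net_count (w : config) (b : bool) (x : vertex) (p : seq vertex) :
    int :=
  (count (fun e => w e == b) (plus_edges x p))%:Z
  - (count (fun e => w e == b) (minus_edges x p))%:Z.

Definition cocycle_property (w : config) : Prop :=
  forall (x y : vertex) (p q : seq vertex),
    self_avoiding_path x y p -> self_avoiding_path x y q ->
    net_count w true x p = net_count w true x q /\
    net_count w false x p = net_count w false x q.

Definition translate (t : vertex) (w : config) : config :=
  fun e => w (e.1 + t, e.2).

Section measures.
Context {R : realType}.
Implicit Type mu : probability config R.

Definition cocycle_measure mu : Prop :=
  {ae mu, forall w, cocycle_property w}.

Definition stationary mu : Prop :=
  forall (t : vertex) (A : set config),
    measurable A -> mu (translate t @^-1` A) = mu A.

Definition ergodic mu : Prop :=
  forall A : set config, measurable A ->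
    (forall t : vertex, translate t @^-1` A = A) ->
    mu A = 0%E \/ mu A = 1%E.

Definition mean_label mu (e : edge) : \bar R :=
  ('E_mu[fun w : config => (w e)%:R])%E.

(* For stationary [mu] the choice of the edge at the origin is immaterial. *)
Definition mean_h mu : \bar R := mean_label mu (hedge 0).
Definition mean_v mu : \bar R := mean_label mu (vedge 0).

End measures.

Definition zero_step (w : config) (x y : vertex) : bool :=
  adj x y && (w (edge_between x y) == false).

Definition zero_cluster (w : config) (z : vertex) : set vertex :=
  [set y | exists p : seq vertex, path (zero_step w) z p /\ last z p = y].

Definition cluster_edges (w : config) (C : set vertex) : set edge :=
  [set e | [/\ w e = false, C (edge_fst e) & C (edge_snd e)]].

Definition biinfinite_path (p : int -> vertex) : Prop :=
  forall i : int, adj (p i) (p (i + 1)).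

Definition biinfinite_edges (p : int -> vertex) : set edge :=
  range (fun i : int => edge_between (p i) (p (i + 1))).

Definition right_down_step (x y : vertex) : bool :=
  (y == x + dir1) || (y == x - dir2).

Definition strictly_nwse (p : int -> vertex) : Prop :=
  (forall i : int, right_down_step (p i) (p (i + 1))) \/
  (forall i : int, right_down_step (p (i + 1)) (p i)).

Definition nwse_zero_path_in (w : config) (C : set vertex)
    (p : int -> vertex) : Prop :=
  [/\ biinfinite_path p, strictly_nwse p &
      biinfinite_edges p `<=` cluster_edges w C].

(* [vedge (a, n)] is the leftmost vertical edge in C between {y = n} and
   {y = n + 1}, that is, the edge e_n. *)
Definition leftmost_vedge (w : config) (C : set vertex) (n a : int) : Prop :=
  cluster_edges w C (vedge (a, n)) /\
  (forall a' : int, cluster_edges w C (vedge (a', n)) -> a <= a').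

Definition left_boundary_defined (w : config) (C : set vertex) : Prop :=
  forall n : int, exists a : int, leftmost_vedge w C n a.

(* The horizontal edges are those between (a, n + 1), the upper endpoint of
   e_n, and (a', n + 1), the lower endpoint of e_(n+1), whichever of the two
   is further left; no label is imposed on them. *)
Definition left_boundary (w : config) (C : set vertex) : set edge :=
  [set e | (exists n a : int, leftmost_vedge w C n a /\ e = vedge (a, n)) \/
           (exists n a a' k : int,
              [/\ leftmost_vedge w C n a, leftmost_vedge w C (n + 1) a',
                  Num.min a a' <= k < Num.max a a' & e = hedge (k, n + 1)])].

(* Main.v *)
Require Import Defs.
From HB Require Import structures.
From mathcomp Require Import all_boot all_order all_algebra.
From mathcomp Require Import boolp classical_sets functions cardinality reals.
From mathcomp Require Import ereal topology normedtype measure lebesgue_measure.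
From mathcomp Require Import numfun lebesgue_integral probability.
From mathcomp Require Import zify.

Set Implicit Arguments.
Unset Strict Implicit.
Unset Printing Implicit Defensive.

Import Order.TTheory GRing.Theory Num.Theory.
Local Open Scope classical_set_scope.
Local Open Scope ring_scope.

(** By the square relation the labels are the increments of a height function
    on Z^2, nondecreasing in both coordinates, and the clusters are the connected
    components of its level sets. A row whose labels are not all 0 a.s. has labels
    1 arbitrarily far to the left: otherwise it has a first 1, and the whole row
    would send unit mass to that edge. If one row is all 0, so are its neighbours,
    hence all rows, which ergodicity and h > 0 exclude. So each level set is
    bounded on the left in each row. An infinite cluster whose rows were bounded
    below (or above) would have a leftmost vertex in its lowest (highest) row, to
    which all its vertices would send mass; hence an infinite cluster meets all
    rows. By monotonicity e_n then lies above L(n), the leftmost point of height k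
    in row n, where k is the height of the cluster; L is nonincreasing, and all of
    [[L(n+1), L(n)]] has height k in row n + 1. *)

(** * Measurability and almost sure statements over countable types *)

Lemma measurable_exists (T : countType) (P : T -> set config) :
  (forall t, measurable (P t)) -> measurable [set w | exists t, P t w].
Proof.
move=> mP.
have -> : [set w | exists t, P t w] = \bigcup_t P t.
  by apply/seteqP; split => [w [t Pt]|w [t _ Pt]]; exists t.
by apply: countable_bigcupT_measurable => //; exact: countableP.
Qed.

Lemma measurable_forall (T : countType) (P : T -> set config) :
  (forall t, measurable (P t)) -> measurable [set w | forall t, P t w].
Proof.
move=> mP.
have -> : [set w | forall t, P t w] = ~` [set w | exists t, (~` P t) w].
  apply/seteqP; split => [w Pw [t]|w Pw t]; first exact.
  by apply: contrapT => nP; apply: Pw; exists t.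
by apply: measurableC; apply: measurable_exists => t; exact: measurableC.
Qed.

Lemma measurable_imply (A B : set config) :
  measurable A -> measurable B -> measurable [set w | A w -> B w].
Proof.
move=> mA mB.
have -> : [set w | A w -> B w] = ~` A `|` B.
  apply/seteqP; split => w /=; last by case=> [nA /nA|].
  by have [Aw /(_ Aw)|] := pselect (A w); [right|left].
by apply: measurableU => //; exact: measurableC.
Qed.

Lemma measurable_label (e : edge) (b : bool) :
  measurable [set w : config | w e = b].
Proof. by apply: (@sub_sigma_algebra _ setT cylinders); exists e, b. Qed.

Lemma measurable_constant (P : Prop) : measurable [set _ : config | P].
Proof.
have [HP|HP] := pselect P.
  by rewrite (_ : [set _ | P] = setT) //; apply/seteqP; split.
by rewrite (_ : [set _ | P] = set0) //; apply/seteqP; split.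
Qed.

Lemma ae_forall (R : realType) (mu : probability config R) (T : countType)
    (P : T -> config -> Prop) :
  (forall t, {ae mu, forall w, P t w}) ->
  {ae mu, forall w, forall t, P t w}.
Proof.
move=> aeP.
(* Natural numbers that code no element of [T] impose no condition. *)
have : {ae mu, forall w, forall n,
    if choice.unpickle n is Some t then P t w else True}.
  apply: ae_foralln => n; case: choice.unpickle => [t|]; first exact: aeP.
  exact: aeW.
by apply: filterS => w Pw t; have := Pw (choice.pickle t); rewrite choice.pickleK.
Qed.

(** * Mass transport, and a consequence of ergodicity *)

(* By stationarity the expected number of [u] with [Q z u] equals the expected
   number of [z'] with [Q z' 0], which is at most one. *)
Lemma ae_finite_mass_transport (R : realType) (mu : probability config R)
    (Q : vertex -> vertex -> set config) :
  stationary mu ->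
  (forall z u, measurable (Q z u)) ->
  (forall t z u w, Q z u (translate t w) <-> Q (z + t) (u + t) w) ->
  (forall w z z' u, Q z u w -> Q z' u w -> z = z') ->
  forall z, {ae mu, forall w, finite_set [set u | Q z u w]}.
Proof.
move=> stat mQ covQ uniqQ z.
pose F n :=
  if (choice.pickle_inv n : option vertex) is Some u then Q z u else set0.
pose G n :=
  if (choice.pickle_inv n : option vertex) is Some u then Q (z - u) 0 else set0.
have mF n : measurable (F n) by rewrite /F; case: choice.pickle_inv.
have mG n : measurable (G n) by rewrite /G; case: choice.pickle_inv.
have FG n : mu (F n) = mu (G n).
  rewrite /F /G; case: choice.pickle_inv => [u|//].
  rewrite -(stat u (Q (z - u) 0)) //; congr (mu _).
  have covQu w : (Q (z - u) 0 (translate u w)) <-> Q z u w.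
    by have := covQ u (z - u) 0 w; rewrite subrK add0r.
  by apply/seteqP; split => w; [exact: (covQu w).2|exact: (covQu w).1].
(* The origin has at most one target, and the target [z - u] determines [u]. *)
have tG : trivIset setT G.
  move=> i j _ _ [w []]; rewrite /G.
  case Ei : (choice.pickle_inv i) => [u|] //.
  case Ej : (choice.pickle_inv j) => [u'|] // Qu Qu'.
  have uu' : u = u' by apply/oppr_inj/(addrI z)/(uniqQ _ _ _ _ Qu Qu').
  have inv_i : oapp choice.pickle i (choice.pickle_inv i : option vertex) = i.
    exact: choice.pickle_invK.
  have inv_j : oapp choice.pickle j (choice.pickle_inv j : option vertex) = j.
    exact: choice.pickle_invK.
  by rewrite -inv_i -inv_j Ei Ej uu'.
(* Borel-Cantelli: the probabilities of the [F n] sum to that of the disjoint union of the [G n],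
   which is at most 1. *)
have F0 : mu (lim_sup_set F) = 0%E.
  apply: lim_sup_set_cvg0 => //.
  have -> : (fun n => \sum_(0 <= i < n) mu (F i))%E =
      (fun n => \sum_(0 <= i < n) mu (G i))%E.
    by apply/funext => n; apply: eq_bigr.
  rewrite -measure_semi_bigcup //; last exact: bigcupT_measurable.
  rewrite (le_lt_trans (probability_le1 mu _)) ?ltry //.
  exact: bigcupT_measurable.
exists (lim_sup_set F); split => //.
  by apply: bigcap_measurableType => n _; apply: bigcup_measurable.
move=> w /= infQ n _; apply: contrapT => nF; apply: infQ.
apply: (@sub_finite_set _ _ (choice.pickle @^-1` `I_n)).
  move=> u /= Qu; rewrite ltnNge; apply/negP => nu; apply: nF.
  by exists (choice.pickle u); [exact: nu|rewrite /F choice.pickleK_inv].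
apply: finite_preimage => //.
by move=> x y _ _; exact: (pcan_inj choice.pickleK).
Qed.

(** The event that all horizontal labels are 0 is translation invariant, so its probability is 0 or
    1, and 1 is incompatible with h > 0. *)
Lemma ae_exists_horizontal_one (R : realType) (mu : probability config R) :
  ergodic mu -> (0 < mean_h mu)%E ->
  {ae mu, forall w, exists z, w (hedge z) = true}.
Proof.
move=> erg; rewrite /mean_h /mean_label => h_gt0.
pose A := [set w : config | forall z, w (hedge z) = false].
have mA : measurable A.
  by apply: measurable_forall => z; exact: measurable_label.
pose B := [set w : config | w (hedge 0) = true].
have mB : measurable B by exact: measurable_label.
have muB : (0 < mu B)%E.
  rewrite -expectation_indic //; apply: (lt_le_trans h_gt0).
  rewrite le_eqVlt; apply/orP; left; apply/eqP; congr expectation.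
  apply/funext => w; rewrite indicE; congr (nat_of_bool _)%:R.
  by apply/idP/idP => [wE|/set_mem //]; rewrite inE.
have A0 : mu A = 0%E.
  have [//|//|A1] := erg A mA; first last.
    have : (mu A <= mu (~` B))%E.
      apply: le_measure; rewrite ?inE //; first exact: measurableC.
      by move=> w /(_ 0); rewrite /B /= => ->.
    rewrite A1 probability_setC //.
    rewrite leeBrDr ?fin_num_measure // => /(lt_le_trans _).
    by move=> /(_ 1%E); rewrite lteDl // => /(_ muB); rewrite ltxx.
  move=> t; apply/seteqP; split => w Aw z; last exact: Aw.
  by have := Aw (z - t); rewrite /translate /= subrK.
exists A; split => // w /= nw z.
by case wz: (w (hedge z)) => //; case: nw; exists z.
Qed.

(** * Translations and basic properties of clusters *)

Lemma up_right_stepD (t x y : vertex) :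
  up_right_step (x + t) (y + t) = up_right_step x y.
Proof. by rewrite /up_right_step ![x + t + _]addrAC !(inj_eq (addIr t)). Qed.

Lemma edge_betweenD (t x y : vertex) :
  edge_between (x + t) (y + t) =
  ((edge_between x y).1 + t, (edge_between x y).2).
Proof.
case: t x y => [t1 t2] [x1 x2] [y1 y2]; rewrite /edge_between /=.
by rewrite -!addr_minl (inj_eq (addIr t2)).
Qed.

Lemma zero_stepD (w : config) (t x y : vertex) :
  zero_step w (x + t) (y + t) = zero_step (translate t w) x y.
Proof. by rewrite /zero_step /adj !up_right_stepD edge_betweenD. Qed.

Lemma edge_betweenC (x y : vertex) : edge_between x y = edge_between y x.
Proof. by rewrite /edge_between minC (minC x.2) eq_sym. Qed.

Lemma zero_stepC (w : config) (x y : vertex) :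
  zero_step w x y = zero_step w y x.
Proof. by rewrite /zero_step /adj orbC edge_betweenC. Qed.

Lemma zero_cluster_refl (w : config) (x : vertex) : zero_cluster w x x.
Proof. by exists [::]. Qed.

Lemma zero_cluster_step (w : config) (x y z : vertex) :
  zero_cluster w x y -> zero_step w y z -> zero_cluster w x z.
Proof.
case=> p [xp py] yz; exists (rcons p z).
by rewrite rcons_path xp py yz last_rcons.
Qed.

Lemma zero_cluster_trans (w : config) (x y z : vertex) :
  zero_cluster w x y -> zero_cluster w y z -> zero_cluster w x z.
Proof.
case=> p [xp py] [q [yq qz]]; exists (p ++ q).
by rewrite cat_path xp last_cat py yq.
Qed.

Lemma zero_cluster_sym (w : config) (x y : vertex) :
  zero_cluster w x y -> zero_cluster w y x.
Proof.
case=> p [xp <-] {y}; elim: p x xp => [|y p IH] x /=.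
  by move=> _; exact: zero_cluster_refl.
case/andP => xy /IH yx; apply: zero_cluster_step yx _.
by rewrite zero_stepC.
Qed.

Lemma zero_cluster_translate (w : config) (t x y : vertex) :
  zero_cluster (translate t w) x y <-> zero_cluster w (x + t) (y + t).
Proof.
have translated w' t' a b : zero_cluster (translate t' w') a b ->
    zero_cluster w' (a + t') (b + t').
  case=> p [ap <-] {b}; exists [seq b + t' | b <- p].
  rewrite (last_map (+%R^~ t')); split => //.
  elim: p a ap => //= b p IH a /andP[ab /IH bp].
  by rewrite zero_stepD ab.
split => [|xy]; first exact: translated.
(* The converse is the same implication for the translation by [- t], which undoes [translate t]. *)
rewrite -[x](addrK t) -[y](addrK t); apply: translated.
rewrite (_ : translate _ _ = w) //; apply/funext => -[z b].
by rewrite /translate /= subrK.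
Qed.

(** The event is a countable union over finite paths, each of which prescribes finitely many
    labels. *)
Lemma measurable_zero_cluster (x y : vertex) :
  measurable [set w : config | zero_cluster w x y].
Proof.
suff mpath p : measurable
    [set w : config | path (zero_step w) x p /\ last x p = y].
  exact: measurable_exists mpath.
elim: p x => [|a p IH] x.
  have -> : [set w : config | path (zero_step w) x [::] /\ last x [::] = y] =
      [set _ | x = y].
    by apply/seteqP; split => w //= [].
  exact: measurable_constant.
have -> : [set w | path (zero_step w) x (a :: p) /\ last x (a :: p) = y] =
    [set _ | adj x a] `&` [set w | w (edge_between x a) = false] `&`
    [set w | path (zero_step w) a p /\ last a p = y].
  apply/seteqP; split => w /=.
    by case=> /andP[/andP[xa /eqP wxa] ap] py.
  by case=> -[xa wxa] [ap py]; rewrite /zero_step xa wxa eqxx.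
apply: measurableI => //; apply: measurableI; first exact: measurable_constant.
exact: measurable_label.
Qed.

(** * Two applications of mass transport *)

(** A first 1 in a row would receive mass from all the infinitely many vertices of that row, whereas
    each vertex sends mass only to the first 1 of its own row. *)
Lemma ae_no_first_one (R : realType) (mu : probability config R) :
  stationary mu ->
  {ae mu, forall w : config, forall z : vertex, w (hedge z) = true ->
    exists2 x : int, x < z.1 & w (hedge (x, z.2)) = true}.
Proof.
move=> stat; apply: ae_forall => z.
pose Q (z u : vertex) := [set w : config | [/\ u.2 = z.2, w (hedge z) = true &
  forall x : int, x < z.1 -> w (hedge (x, z.2)) = false]].
have mQ z' u : measurable (Q z' u).
  rewrite (_ : Q z' u = [set _ | u.2 = z'.2] `&`
    [set w | w (hedge z') = true] `&` [set w | forall x : int,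
      x < z'.1 -> w (hedge (x, z'.2)) = false]).
    apply: measurableI; first apply: measurableI.
    - exact: measurable_constant.
    - exact: measurable_label.
    apply: measurable_forall => x; apply: measurable_imply.
      exact: measurable_constant.
    exact: measurable_label.
  by apply/seteqP; split => w /=; [case|case=> -[]].
have covQ t z' u w : Q z' u (translate t w) <-> Q (z' + t) (u + t) w.
  rewrite /Q /=; split=> -[uz wz z0]; split => //.
  - by rewrite uz.
  - move=> x xz; have := z0 (x - t.1); rewrite ltrBlDr => /(_ xz).
    by rewrite /translate /hedge /= -[_ + t]/(_, _) /= subrK.
  - exact: addIr uz.
  - move=> x xz; have := z0 (x + t.1); rewrite ltrD2r => /(_ xz).
    by rewrite /translate.
have uniqQ w z1 z2 u : Q z1 u w -> Q z2 u w -> z1 = z2.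
  case: z1 z2 => [x1 y1] [x2 y2] [/= <- w1 l1] [/= <- w2 l2].
  congr (_, _); apply/eqP; rewrite eq_le !leNgt; apply/andP; split.
    by apply/negP => /l1; rewrite w2.
  by apply/negP => /l2; rewrite w1.
have := ae_finite_mass_transport stat mQ covQ uniqQ z.
apply: filterS => w finQ wz; apply: contrapT => nx.
apply: infinite_nat.
pose f (n : nat) : vertex := (n%:Z, z.2).
apply: (@sub_finite_set _ _ (f @^-1` [set u | Q z u w])).
  move=> n _; split => // x xz; apply/negbTE/negP => wx.
  by apply: nx; exists x.
by apply: finite_preimage finQ => m n _ _ [].
Qed.

(* A cluster with a least vertex transports the mass of each of its vertices to
   that vertex. *)
Lemma ae_finite_cluster_with_min (R : realType) (mu : probability config R)
    (le : rel vertex) :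
  stationary mu -> antisymmetric le ->
  (forall t x y, le (x + t) (y + t) = le x y) ->
  {ae mu, forall w : config, forall z : vertex,
    (forall y, zero_cluster w z y -> le z y) -> finite_set (zero_cluster w z)}.
Proof.
move=> stat le_anti leD; apply: ae_forall => z.
pose Q (z u : vertex) := [set w : config | zero_cluster w z u /\
  forall y, zero_cluster w z y -> le z y].
have mQ z' u : measurable (Q z' u).
  apply: measurableI; first exact: measurable_zero_cluster.
  apply: measurable_forall => y; apply: measurable_imply.
    exact: measurable_zero_cluster.
  exact: measurable_constant.
have covQ t z' u w : Q z' u (translate t w) <-> Q (z' + t) (u + t) w.
  have covC x y := zero_cluster_translate w t x y.
  split=> -[zu le_z]; split.
  - exact: (covC _ _).1 zu.
  - move=> y zy; rewrite -[y](subrK t) leD; apply: le_z.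
    by apply: (covC _ _).2; rewrite subrK.
  - exact: (covC _ _).2 zu.
  - by move=> y /(covC _ _).1 /le_z; rewrite leD.
have uniqQ w z1 z2 u : Q z1 u w -> Q z2 u w -> z1 = z2.
  case=> zu1 le1 [zu2 le2].
  have z12 := zero_cluster_trans zu1 (zero_cluster_sym zu2).
  by apply: le_anti; rewrite le1 //= le2 //; exact: zero_cluster_sym.
have := ae_finite_mass_transport stat mQ covQ uniqQ z.
apply: filterS => w finQ le_z.
by apply: sub_finite_set finQ => u zu; split.
Qed.

(** * Minima, induction and primitives on the integers *)

Lemma int_exists_min (P : int -> Prop) (a b : int) :
  P a -> (forall x, P x -> b <= x) ->
  exists2 m, P m & forall x, P x -> m <= x.
Proof.
move=> Pa lbP.
have exP : exists n : nat, `[< P (b + n%:Z) >].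
  exists `|a - b|%N; apply/asboolP.
  by rewrite (_ : b + _ = a) //; have := lbP a Pa; lia.
case: (ex_minnP exP) => n /asboolP Pn min_n; exists (b + n%:Z) => // x Px.
have bx := lbP x Px.
have /min_n : `[< P (b + `|x - b|%N%:Z) >].
  by apply/asboolP; rewrite (_ : b + _ = x) //; lia.
lia.
Qed.

Lemma int_shift_ind (P : int -> Prop) (a : int) :
  P a -> (forall n : int, P n <-> P (n + 1)) -> forall n, P n.
Proof.
move=> Pa PS n; rewrite -(subrK a n); elim/int_ind: (n - a) => [|m|m].
- by rewrite add0r.
- by move/PS; rewrite -[m.+1]addn1 PoszD addrAC.
- by move=> Pm; apply/PS; rewrite -addn1 PoszD opprD addrAC subrK.
Qed.

(** Serves to sum labels along a row or a column into a height. At negative arguments the sum runs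
    backwards from -1 and is subtracted. *)
Lemma int_primitive (g : int -> int) :
  exists F : int -> int, forall n : int, F (n + 1) = F n + g n.
Proof.
exists (fun n => match n with
  | Posz m => \sum_(i < m) g i%:Z
  | Negz m => - \sum_(i < m.+1) g (Negz i)
  end).
case=> [m|[|m]].
- by rewrite -PoszD addn1 big_ord_recr.
- by rewrite big_ord_recr big_ord0 /= big_ord0 add0r addNr.
- rewrite (_ : Negz m.+1 + 1 = Negz m); last by lia.
  by rewrite [in RHS]big_ord_recr /= opprD subrK.
Qed.

Lemma int_nondecreasing (F : int -> int) :
  (forall n : int, F n <= F (n + 1)) -> forall m n : int, m <= n -> F m <= F n.
Proof.
move=> FS m n mn; rewrite (_ : n = m + `|n - m|%N%:Z); last by lia.
elim: `|n - m|%N => [|d IH]; first by rewrite addr0.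
by apply: le_trans IH _; rewrite -addn1 PoszD addrA.
Qed.

(** * Steps and the edges they cross *)

Lemma up_right_step_dir1 (z : vertex) : up_right_step z (z + dir1).
Proof. by rewrite /up_right_step eqxx. Qed.

Lemma up_right_step_dir2 (z : vertex) : up_right_step z (z + dir2).
Proof. by rewrite /up_right_step eqxx orbT. Qed.

Lemma up_right_step_asym (x y : vertex) :
  up_right_step x y -> up_right_step y x = false.
Proof.
case: x y => [x1 x2] [y1 y2]; rewrite /up_right_step.
rewrite -[_ + dir1]/(_, _) -[_ + dir2]/(_, _) -[(y1, y2) + dir1]/(_, _).
rewrite -[(y1, y2) + dir2]/(_, _) !xpair_eqE /=; lia.
Qed.

Lemma edge_between_dir1 (x y : int) :
  edge_between (x, y) (x + 1, y) = hedge (x, y).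
Proof.
by rewrite /edge_between /hedge /= eqxx minxx (min_idPl _) //; lia.
Qed.

Lemma edge_between_dir2 (x y : int) :
  edge_between (x, y) (x, y + 1) = vedge (x, y).
Proof.
rewrite /edge_between /vedge /= minxx (min_idPl _); last by lia.
by congr (_, _); lia.
Qed.

Lemma adj_cases (u v : vertex) : adj u v ->
  [\/ v = (u.1 + 1, u.2), v = (u.1, u.2 + 1),
      u = (v.1 + 1, v.2) | u = (v.1, v.2 + 1)].
Proof.
case: u v => [u1 u2] [v1 v2] /orP[] /orP[] /eqP ->.
- by apply: Or41; congr (_, _); rewrite /= addr0.
- by apply: Or42; congr (_, _); rewrite /= addr0.
- by apply: Or43; congr (_, _); rewrite /= addr0.
- by apply: Or44; congr (_, _); rewrite /= addr0.
Qed.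

Lemma zero_step_h (w : config) (x y : int) :
  zero_step w (x, y) (x + 1, y) = ~~ w (hedge (x, y)).
Proof.
rewrite /zero_step edge_between_dir1 eqbF_neg /adj /up_right_step.
rewrite (_ : (x, y) + dir1 = (x + 1, y)) ?eqxx //.
by congr (_, _); rewrite /= addr0.
Qed.

Lemma zero_step_v (w : config) (x y : int) :
  zero_step w (x, y) (x, y + 1) = ~~ w (vedge (x, y)).
Proof.
rewrite /zero_step edge_between_dir2 eqbF_neg /adj /up_right_step.
rewrite (_ : (x, y) + dir2 = (x, y + 1)) ?eqxx ?orbT //.
by congr (_, _); rewrite /= addr0.
Qed.

(** * The square relation and the height function *)

(** Compares the two up-right paths around a unit square, which have no backward steps. *)
Lemma cocycle_square (w : config) (x y : int) : cocycle_property w ->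
  (w (hedge (x, y)) + w (vedge ((x + 1)%R, y)) =
   w (vedge (x, y)) + w (hedge (x, (y + 1)%R)))%N.
Proof.
move=> cw.
have s1 a b : up_right_step (a, b) (a + 1, b).
  by have := up_right_step_dir1 (a, b); rewrite -[_ + dir1]/(_, _) /= addr0.
have s2 a b : up_right_step (a, b) (a, b + 1).
  by have := up_right_step_dir2 (a, b); rewrite -[_ + dir2]/(_, _) /= addr0.
have [] := cw (x, y) (x + 1, y + 1) [:: (x + 1, y); (x + 1, y + 1)]
    [:: (x, y + 1); (x + 1, y + 1)].
- rewrite /self_avoiding_path /= /adj s1 s2 eqxx !inE !xpair_eqE /=; lia.
- rewrite /self_avoiding_path /= /adj s1 s2 eqxx !inE !xpair_eqE /=; lia.
move=> + _; rewrite /net_count /plus_edges /minus_edges /steps /=.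
rewrite !s1 !s2 !(up_right_step_asym (s1 _ _)) !(up_right_step_asym (s2 _ _)) /=.
rewrite !edge_between_dir1 !edge_between_dir2 !eqb_id /=; lia.
Qed.

Definition height_function (w : config) (f : int -> int -> int) : Prop :=
  (forall x y : int, f (x + 1) y = f x y + (w (hedge (x, y)))%:Z) /\
  (forall x y : int, f x (y + 1) = f x y + (w (vedge (x, y)))%:Z).

(** Labels are summed along column 0 and then along each row. The vertical increments are right on
    column 0, and the square relation carries them to all columns. *)
Lemma cocycle_height (w : config) :
  cocycle_property w -> exists f, height_function w f.
Proof.
move=> cw.
have [F FE] := choice (fun y => int_primitive
  (fun x => (w (hedge (x, y)))%:Z)).
have [V VE] := int_primitive (fun y => (w (vedge (0, y)))%:Z).
exists (fun x y => V y + F y x - F y 0).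
split=> x y; first by rewrite FE /=; lia.
move: x; apply: (@int_shift_ind _ 0) => [|x]; first by rewrite VE /=; lia.
have := cocycle_square x y cw; rewrite !FE /=.
lia.
Qed.

Section height.
Context (w : config) (f : int -> int -> int) (hf : height_function w f).

Lemma height_homo_x (y x x' : int) : x <= x' -> f x y <= f x' y.
Proof.
by apply: (int_nondecreasing (F := f^~ y)) => n; rewrite hf.1 lerDl.
Qed.

Lemma hedge_zeroE (x y : int) :
  (w (hedge (x, y)) = false) <-> (f (x + 1) y = f x y).
Proof. by rewrite hf.1; case: (w _) => /=; split; lia. Qed.

Lemma vedge_zeroE (x y : int) :
  (w (vedge (x, y)) = false) <-> (f x (y + 1) = f x y).
Proof. by rewrite hf.2; case: (w _) => /=; split; lia. Qed.

Lemma zero_step_height (u v : vertex) :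
  zero_step w u v -> f u.1 u.2 = f v.1 v.2.
Proof.
move=> uv; have /andP[/adj_cases uv_adj _] := uv.
case: u v uv uv_adj => [u1 u2] [v1 v2] uv [] /= [E1 E2]; subst.
- by move: uv; rewrite zero_step_h => /negbTE /hedge_zeroE ->.
- by move: uv; rewrite zero_step_v => /negbTE /vedge_zeroE ->.
- by move: uv; rewrite zero_stepC zero_step_h => /negbTE /hedge_zeroE ->.
- by move: uv; rewrite zero_stepC zero_step_v => /negbTE /vedge_zeroE ->.
Qed.

Lemma zero_cluster_height (z u : vertex) :
  zero_cluster w z u -> f u.1 u.2 = f z.1 z.2.
Proof.
case=> p [zp <-]; elim: p z zp => //= a p IH z /andP[/zero_step_height -> ap].
exact: IH.
Qed.

(** The height is monotone along the row, so equal heights at both ends make it constant in between,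
    and all edges between them carry 0. *)
Lemma zero_cluster_left (z : vertex) (x x' y : int) :
  zero_cluster w z (x, y) -> x' <= x -> f x' y = f x y ->
  zero_cluster w z (x', y).
Proof.
move=> zx x'x; rewrite (_ : x' = x - `|x - x'|%N%:Z); last by lia.
elim: `|x - x'|%N => [|n IH]; first by rewrite subr0.
rewrite (_ : x - n.+1%:Z = x - n%:Z - 1); last by lia.
move=> fE; have f1 : f (x - n%:Z) y = f x y.
  have := @height_homo_x y (x - n%:Z - 1) (x - n%:Z) ltac:(lia).
  have := @height_homo_x y (x - n%:Z) x ltac:(lia).
  lia.
apply: zero_cluster_step (IH f1) _; rewrite zero_stepC.
rewrite -[X in zero_step w _ (X, y)](subrK 1) zero_step_h.
by apply/negbT/hedge_zeroE; rewrite subrK f1.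
Qed.

(** The step that first takes the path above row [n] is a vertical edge labelled 0 from row [n] to
    row [n + 1]. *)
Lemma zero_cluster_crossing (z : vertex) (n : int) (p : seq vertex) :
  path (zero_step w) z p -> z.2 <= n -> n < (last z p).2 ->
  exists x, zero_cluster w z (x, n) /\ zero_cluster w z (x, n + 1).
Proof.
elim: p z => [|a p IH] z /=; first by move=> _; lia.
case/andP=> za ap zn np.
have za' := zero_cluster_step (zero_cluster_refl w z) za.
have [an|an] := leP a.2 n.
  have [x [ax ax']] := IH a ap an np.
  by exists x; split; exact: zero_cluster_trans za' _.
have /andP[/adj_cases za_adj _] := za.
exists z.1; case: z a za_adj zn an za' {za ap IH np}
  => [z1 z2] [a1 a2] [] [-> ->] /=; try lia.
move=> zn an za'; rewrite (_ : n = z2); last by lia.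
by split => //; exact: zero_cluster_refl.
Qed.

(** A 1 in the row forces another one further left, and two ones make the height vary by 2. *)
Lemma row_all_zero (y : int) (c : int) :
  (forall z : vertex, w (hedge z) = true ->
    exists2 x : int, x < z.1 & w (hedge (x, z.2)) = true) ->
  (forall x, c <= f x y <= c + 1) -> forall x, w (hedge (x, y)) = false.
Proof.
move=> no_first bnd x; apply/negbTE/negP => wx.
have [x' /= x'x wx'] := no_first _ wx.
have := hf.1 x y; have := hf.1 x' y; rewrite wx wx' /=.
have := @height_homo_x y (x' + 1) x ltac:(lia).
have := bnd x'; have := bnd (x + 1); lia.
Qed.

Lemma row_zero_height (y : int) :
  (forall x, w (hedge (x, y)) = false) -> forall x, f x y = f 0 y.
Proof.
move=> w0; apply: (@int_shift_ind (fun x => f x y = f 0 y) 0) => // x.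
by rewrite hf.1 w0 addr0.
Qed.

Lemma ones_unbounded_left :
  (forall z : vertex, w (hedge z) = true ->
    exists2 x : int, x < z.1 & w (hedge (x, z.2)) = true) ->
  (exists z, w (hedge z) = true) ->
  forall x y : int, exists2 x', x' < x & w (hedge (x', y)) = true.
Proof.
move=> no_first [[x0 y0] w0] x y.
(* Heights in adjacent rows differ by 0 or 1, so next to a row of constant height only two
   consecutive heights can occur, as [row_all_zero] requires. *)
have zeroS b : (forall a, w (hedge (a, b)) = false) <->
    (forall a, w (hedge (a, b + 1)) = false).
  split=> /row_zero_height const.
    apply: (row_all_zero (c := f 0 b)) => // a.
    by rewrite hf.2 const; lia.
  apply: (row_all_zero (c := f 0 (b + 1) - 1)) => // a.
  by rewrite -(const a) hf.2; lia.
have [a wa] : exists a, w (hedge (a, y)) = true.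
  apply: contrapT => nex.
  suff /(_ y0 x0) : forall b a, w (hedge (a, b)) = false by rewrite w0.
  apply: (@int_shift_ind (fun b => forall a, w (hedge (a, b)) = false) y) => // a.
  apply/negbTE/negP => wa.
  by apply: nex; exists a.
(* With no 1 to the left of [x], row [y] would have a first 1. *)
apply: contrapT => nex.
have x_lb b : w (hedge (b, y)) = true -> x <= b.
  by move=> wb; rewrite leNgt; apply/negP => bx; apply: nex; exists b.
have [m wm min_m] := int_exists_min wa x_lb.
have [b /= bm wb] := no_first _ wm.
by have := min_m _ wb; rewrite leNgt bm.
Qed.

Lemma height_unbounded_left :
  (forall x y : int, exists2 x', x' < x & w (hedge (x', y)) = true) ->
  forall y k : int, exists x, f x y < k.
Proof.
move=> ones y k.
have [fk|fk] := leP k (f 0 y); last by exists 0.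
suff /(_ `|f 0 y - k|%N.+1)[x fx] (n : nat) : exists x, f x y <= f 0 y - n%:Z.
  by exists x; lia.
elim: n => [|n [x fx]]; first by exists 0; lia.
have [x' x'x wx'] := ones x y; exists x'.
have := hf.1 x' y; rewrite wx' /=.
have := @height_homo_x y (x' + 1) x ltac:(lia); lia.
Qed.

End height.

(** * The staircase path *)

(** The path runs right along row [n + 1] from [L (n + 1)] to [L n], down the edge at [L n], and on
    along row [n]. *)
Lemma staircase (L : int -> int) : (forall n : int, L (n + 1) <= L n) ->
  exists p : int -> vertex, (forall i, right_down_step (p i) (p (i + 1))) /\
    biinfinite_edges p = [set e | (exists n : int, e = vedge (L n, n)) \/
      (exists n k : int, L (n + 1) <= k < L n /\ e = hedge (k, n + 1))].
Proof.
move=> LS.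
have L_anti (m n : int) : m <= n -> L n <= L m.
  move=> mn; rewrite -lerN2.
  by apply: (int_nondecreasing (F := fun n => - L n)) => // i; rewrite lerN2.
(* Along the path [x - y] grows by one at each step, so it serves as parameter:
   [Y i] is the row of the vertex with [x - y = i]. *)
have exY (i : int) : exists y : int, L y - y <= i < L (y - 1) - (y - 1).
  (* [a] is so large that, by monotonicity of [L], row [a] satisfies [L y - y <= i] and no row below
     [- a] does. *)
  have [a [a_ge0 aP]] : exists a : int, 0 <= a /\ L 0 - a <= i < L 0 + a.
    by exists (`|L 0 - i| + 1); lia.
  have exD : L a - a <= i by have := L_anti 0 a a_ge0; lia.
  have lbD (y : int) : L y - y <= i -> - a <= y.
    by have [/L_anti|] := leP y 0; lia.
  have [m mP min_m] := @int_exists_min (fun y => L y - y <= i) _ _ exD lbD.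
  by exists m; rewrite mP ltNge; apply/negP => /min_m; lia.
have [Y YP] := choice exY.
(* [L y - y] is strictly decreasing in [y], so the two bounds single out one row. *)
have Y_eq (i y : int) : L y - y <= i < L (y - 1) - (y - 1) -> Y i = y.
  move=> yP; apply/eqP; rewrite eq_le !leNgt; apply/andP.
  split; apply/negP => lt_y.
    by have := L_anti y (Y i - 1); have := YP i; lia.
  by have := L_anti (Y i) (y - 1); have := YP i; lia.
pose p (i : int) : vertex := (i + Y i, Y i).
(* The path steps right until it stands at [L (Y i - 1)], the end of its row, and then steps
   down. *)
have p_step (i : int) :
    (L (Y i) <= i + Y i < L (Y i - 1) /\ p (i + 1) = (i + Y i + 1, Y i)) \/
    (i + Y i = L (Y i - 1) /\ p (i + 1) = (i + Y i, Y i - 1)).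
  have YPi := YP i; have [lt_i|ge_i] := ltP (i + 1) (L (Y i - 1) - (Y i - 1)).
    left; have Yi1 : Y (i + 1) = Y i by apply: Y_eq; lia.
    by split; [lia|rewrite /p Yi1; congr (_, _); lia].
  right; have Yi1 : Y (i + 1) = Y i - 1.
    by apply: Y_eq; have := LS (Y i - 1 - 1); rewrite subrK; lia.
  by split; [lia|rewrite /p Yi1; congr (_, _); lia].
exists p; split.
  move=> i; rewrite /right_down_step; case: (p_step i) => -[_ ->].
    by apply/orP; left; apply/eqP; congr (_, _); rewrite /= ?addr0.
  by apply/orP; right; apply/eqP; congr (_, _); rewrite /= ?subr0.
apply/seteqP; split => [_ [i _ <-]|e] /=.
  case: (p_step i) => -[iP ->].
    right; exists (Y i - 1), (i + Y i); rewrite subrK; split=> //.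
    exact: edge_between_dir1.
  left; exists (Y i - 1); rewrite /p iP.
  by rewrite edge_betweenC -edge_between_dir2 subrK.
case=> [[n ->]|[n [k [nk ->]]]].
  (* The edge at [L n] is crossed downwards, so its parameter is that of its upper endpoint
     [(L n, n + 1)]. *)
  exists (L n - n - 1) => //.
  rewrite /p (Y_eq _ (n + 1)); last by rewrite addrK; have := LS n; lia.
  rewrite (Y_eq _ n); last by have := LS (n - 1); rewrite subrK; lia.
  rewrite edge_betweenC -edge_between_dir2.
  by congr (edge_between (_, _) (_, _)); lia.
exists (k - n - 1) => //.
rewrite /p !(Y_eq _ (n + 1)); try by rewrite (addrK 1 n); lia.
by rewrite -edge_between_dir1; congr (edge_between (_, _) (_, _)); lia.
Qed.

(** * From infinite clusters to their left boundary *)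

(* The least vertex of a set is the leftmost one of its lowest row if [s = 1],
   of its highest row if [s = -1]. *)
Definition lex_le (s : int) (u v : vertex) : bool :=
  (s * u.2 < s * v.2) || (u.2 == v.2) && (u.1 <= v.1).

Lemma lex_le_anti (s : int) : antisymmetric (lex_le s).
Proof.
move=> [u1 u2] [v1 v2]; rewrite /lex_le /= => uv.
have E2 : u2 = v2.
  case/andP: uv => /orP[lt_uv|/andP[/eqP //]] /orP[lt_vu|/andP[/eqP //]].
  by have := lt_trans lt_uv lt_vu; rewrite ltxx.
by move: uv; rewrite E2 ltxx eqxx /= -eq_le => /eqP ->.
Qed.

Lemma lex_leD (s : int) (t u v : vertex) :
  lex_le s (u + t) (v + t) = lex_le s u v.
Proof.
case: t u v => [t1 t2] [u1 u2] [v1 v2]; rewrite /lex_le /=.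
by rewrite !mulrDr ltrD2r lerD2r (inj_eq (addIr _)).
Qed.

(** No randomness remains here: the first four hypotheses are the almost sure properties, and the
    rest is deduced for a single configuration. *)
Lemma nwse_left_boundary (w : config) (z : vertex) :
  cocycle_property w ->
  (exists u, w (hedge u) = true) ->
  (forall u : vertex, w (hedge u) = true ->
    exists2 x : int, x < u.1 & w (hedge (x, u.2)) = true) ->
  (forall (s : int) u, s = 1 \/ s = -1 ->
    (forall v, zero_cluster w u v -> lex_le s u v) ->
    finite_set (zero_cluster w u)) ->
  infinite_set (zero_cluster w z) ->
  left_boundary_defined w (zero_cluster w z) /\
  exists p : int -> vertex, nwse_zero_path_in w (zero_cluster w z) p /\
    biinfinite_edges p = left_boundary w (zero_cluster w z).
Proof.
move=> cw ex_one no_first no_min infC.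
have [f hf] := cocycle_height cw.
have f_left := height_unbounded_left hf (ones_unbounded_left hf no_first ex_one).
pose k := f z.1 z.2.
pose C := zero_cluster w z.
have Ck (x y : int) : C (x, y) -> f x y = k.
  by move/(zero_cluster_height hf).
have f_homo := height_homo_x hf.
have f_lb (y : int) : exists b : int, forall x : int, k <= f x y -> b <= x.
  have [b fb] := f_left y k; exists b => x kx; rewrite leNgt; apply/negP => xb.
  by have := f_homo y x b (ltW xb); rewrite leNgt (lt_le_trans fb kx).
(* [s = 1] gives vertices of [C] arbitrarily low, [s = -1] arbitrarily high. Otherwise the leftmost
   vertex of the extreme row is least in [C], and [no_min] makes [C] finite. *)
have unbounded (s b : int) : s = 1 \/ s = -1 -> exists2 u, C u & s * u.2 < b.
  move=> s1; apply: contrapT => nex; apply: infC.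
  have lb (m : int) : (exists2 u, C u & s * u.2 = m) -> b <= m.
    move=> [u Cu <-]; rewrite leNgt; apply/negP => ub.
    by apply: nex; exists u.
  have Cz : exists2 u, C u & s * u.2 = s * z.2.
    by exists z => //; exact: zero_cluster_refl.
  have [m [[u1 u2] /= Cu um] min_m] := int_exists_min Cz lb.
  have [c c_lb] := f_lb u2.
  have lb_row (x : int) : C (x, u2) -> c <= x.
    by move=> /Ck fx; apply: c_lb; rewrite fx.
  have [x Cx min_x] := int_exists_min Cu lb_row.
  have finCx : finite_set (zero_cluster w (x, u2)).
    apply: (no_min s) => // -[v1 v2] /(zero_cluster_trans Cx) Cv.
    rewrite /lex_le /=; have : m <= s * v2 by apply: min_m; exists (v1, v2).
    rewrite -um le_eqVlt => /orP[/eqP uv|->] //.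
    have uv2 : u2 = v2 by case: s1 uv => ->; lia.
    by rewrite uv2 eqxx min_x ?orbT // uv2.
  apply: sub_finite_set finCx => v Cv.
  by apply: zero_cluster_trans Cv; exact: zero_cluster_sym.
have crossing (n : int) : exists x : int, C (x, n) /\ C (x, n + 1).
  have [u Cu un] := unbounded 1 (n + 1) (or_introl erefl).
  have [v Cv vn] := unbounded (-1) (- n) (or_intror erefl).
  have [p [up pv]] := zero_cluster_trans (zero_cluster_sym Cu) Cv.
  have un' : u.2 <= n by lia.
  have vn' : n < (last u p).2 by rewrite pv; lia.
  have [x [ux ux']] := zero_cluster_crossing up un' vn'.
  by exists x; split; exact: zero_cluster_trans Cu _.
(* The minimum is over all points of height [k] in row [n], not only those in [C]. In row [n + 1]
   the height at [l] is squeezed between [f l n] and the height at the crossing, so [C] extends left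
   from the crossing to [l] in both rows. *)
have exL (n : int) : exists l : int,
    [/\ C (l, n), C (l, n + 1) & forall x : int, f x n = k -> l <= x].
  have [x [Cx Cx']] := crossing n; have [b b_lb] := f_lb n.
  have lb_row (a : int) : f a n = k -> b <= a
    by move=> fa; apply: b_lb; rewrite fa.
  have [l lk min_l] := int_exists_min (Ck _ _ Cx) lb_row.
  have lx := min_l x (Ck _ _ Cx).
  have lk' : f l (n + 1) = k.
    apply/eqP; rewrite eq_le -{1}(Ck _ _ Cx') f_homo // -lk hf.2.
    by rewrite lerDl.
  exists l; split => //.
    by apply: (zero_cluster_left hf Cx lx); rewrite lk (Ck _ _ Cx).
  by apply: (zero_cluster_left hf Cx' lx); rewrite lk' (Ck _ _ Cx').
have [L LP] := choice exL.
have CL (n : int) : cluster_edges w C (vedge (L n, n)).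
  have [CL1 CL2 _] := LP n; split.
  - by apply/(vedge_zeroE hf); rewrite (Ck _ _ CL1) (Ck _ _ CL2).
  - exact: CL1.
  - by rewrite (_ : edge_snd _ = (L n, n + 1)) //; congr (_, _); rewrite /= addr0.
have leftL (n : int) : leftmost_vedge w C n (L n).
  split=> // x [_ Cx _]; have [_ _] := LP n; apply.
  exact: Ck Cx.
have leftE (n a : int) : leftmost_vedge w C n a -> a = L n.
  move=> [ae a_min]; have [_ L_min] := leftL n.
  by apply/eqP; rewrite eq_le a_min // L_min.
(* The upper endpoint of the edge at [L n] has height [k], so it is not to the left of
   [L (n + 1)]. *)
have LS (n : int) : L (n + 1) <= L n.
  have [_ CL2 _] := LP n; have [_ _] := LP (n + 1); apply.
  exact: Ck CL2.
(* Monotonicity pins the height to [k] between the two ends, so [C] reaches these points from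
   [(L n, n + 1)]. *)
have Crow (n x : int) : L (n + 1) <= x <= L n -> C (x, n + 1).
  case/andP=> Lx xL; have [_ CL2 _] := LP n; have [CL1 _ _] := LP (n + 1).
  apply: (zero_cluster_left hf CL2 xL); apply/eqP; rewrite eq_le f_homo //=.
  by rewrite (Ck _ _ CL2) -(Ck _ _ CL1) f_homo.
have boundaryE : left_boundary w C = [set e |
    (exists n : int, e = vedge (L n, n)) \/
    (exists n x : int, L (n + 1) <= x < L n /\ e = hedge (x, n + 1))].
  apply/seteqP; split=> e [].
  - by case=> n [a [/leftE -> ->]]; left; exists n.
  - case=> n [a [a' [x [/leftE -> /leftE ->]]]].
    rewrite (min_idPr (LS n)) (max_idPl (LS n)) => Lx ->.
    by right; exists n, x.
  - by case=> n ->; left; exists n, (L n).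
  - case=> n [x [Lx ->]]; right; exists n, (L n), (L (n + 1)), x.
    by rewrite (min_idPr (LS n)) (max_idPl (LS n)).
split; first by move=> n; exists (L n).
have [p [p_step pE]] := staircase LS.
exists p; rewrite pE boundaryE; split=> //; split.
- move=> i; have /orP[/eqP ->|/eqP pS] := p_step i.
    by rewrite /adj up_right_step_dir1.
  rewrite /adj orbC -[X in up_right_step _ X](subrK dir2) -pS.
  by rewrite up_right_step_dir2.
- by left.
rewrite pE => e [[n ->]|[n [x [Lx ->]]]]; first exact: CL.
have Cx : C (x, n + 1) by apply: Crow; lia.
have Cx1 : C (x + 1, n + 1) by apply: Crow; lia.
split => //.
  by apply/(hedge_zeroE hf); rewrite (Ck _ _ Cx) (Ck _ _ Cx1).
by rewrite (_ : edge_snd _ = (x + 1, n + 1)) //; congr (_, _); rewrite /= addr0.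
Qed.

Theorem lemma3p4 (R : realType) (mu : probability config R)
  (hcocycle : cocycle_measure mu)
  (hstat : stationary mu)
  (herg : ergodic mu)
  (hh : (0 < mean_h mu < 1)%E)
  (hv : (0 < mean_v mu < 1)%E) :
  {ae mu, forall w : config, forall z : vertex,
    infinite_set (zero_cluster w z) ->
    (exists p : int -> vertex, nwse_zero_path_in w (zero_cluster w z) p) /\
    left_boundary_defined w (zero_cluster w z) /\
    (exists p : int -> vertex,
       nwse_zero_path_in w (zero_cluster w z) p /\
       biinfinite_edges p = left_boundary w (zero_cluster w z))}.
Proof.
have /andP[h_gt0 _] := hh.
(* Almost surely an infinite cluster has no leftmost vertex in a lowest row ([s = 1]) or in a
   highest row ([s = -1]). *)
have fin_min s := ae_finite_cluster_with_min hstat (@lex_le_anti s) (lex_leD s).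
have no_min_ae : {ae mu, forall w, forall (s : int) u, s = 1 \/ s = -1 ->
    (forall v, zero_cluster w u v -> lex_le s u v) ->
    finite_set (zero_cluster w u)}.
  apply: filterS2 (fin_min 1) (fin_min (-1)) => w min_bot min_top s u [] ->.
    exact: min_bot.
  exact: min_top.
have cocycle_ae : {ae mu, forall w, cocycle_property w /\
    exists u, w (hedge u) = true}.
  by apply: filterS2 hcocycle (ae_exists_horizontal_one herg h_gt0) => w.
apply: filterS3 cocycle_ae (ae_no_first_one hstat) no_min_ae.
move=> w [cw ex_one] no_first no_min z infC.
have [defB [p [pC pB]]] := nwse_left_boundary cw ex_one no_first no_min infC.
by split; [exists p|split => //; exists p].
Qed.
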